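(* Let $q>0$, let $\mathcal U=U_q(\mathfrak g_c)$ be the compact form of the quantum enveloping algebra of a complex simple Lie algebra of rank $n$, let $\rho$ be a unitary representation of $\mathcal U$ on a pre-Hilbert space $D$, let $\Omega\in D$, and let $(j_{st})_{0\le s\le t}$ be a Lévy process on $\mathcal U$ (with values in a $*$-algebra $\mathcal A$ with state $\Phi$) with generator $\psi(u)=\langle\Omega,(\rho(u)-\varepsilon(u))\Omega\rangle$. Write $\Omega=\sum_{\lambda\in\Lambda_\Omega}v_\lambda$ with $\Lambda_\Omega\subseteq\mathbb Z^n$ and $\rho(k_i)v_\lambda=q^{\lambda_i/2}v_\lambda$ for $i=1,\dots,n$, and set $c_\lambda=\|v_\lambda\|^2$. Let $\{(N^{(\lambda)}_t)_{t\in\mathbb R_+};\lambda\in\Lambda_\Omega\}$ be a family of independent (rate one) Poisson processes and define a jump process $(N_t)_{t\in\mathbb R_+}=((N_1(t),\dots,N_n(t)))_{t\in\mathbb R_+}$ with values in the lattice generated by $\Lambda_\Omega$ by $$N_t=\sum_{\lambda\in\Lambda_\Omega}\lambda\,N^{(\lambda)}_{c_\lambda t},\qquad t\in\mathbb R_+.$$ Then $$\big(\hat k_1(s,t),\dots,\hat k_n(s,t)\big)=\big(q^{(N_1(t)-N_1(s))/2},\dots,q^{(N_n(t)-N_n(s))/2}\big)$$ is a classical version of $(j_{st}(k_1),\dots,j_{st}(k_n))$, i.e. $$\Phi\big(j_{s_1t_1}(k^{\mu_1})\cdots j_{s_mt_m}(k^{\mu_m})\big)=\mathbb E\big(\hat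 k^{\mu_1}(s_1,t_1)\cdots\hat k^{\mu_m}(s_m,t_m)\big)$$ for all $m\in\mathbb N$, $\mu_1,\dots,\mu_m\in\mathbb Z^n$ and all $s_l,t_l\in\mathbb R_+$ with $s_l\le t_l$, $l=1,\dots,m$.
   Context: Let $\mathfrak g$ be a complex simple Lie algebra with Cartan matrix $(a_{ij})_{1\le i,j\le n}$, let $(d_i)_{1\le i\le n}$ be non-zero integers with $d_ia_{ij}=d_ja_{ji}$ and greatest common divisor $1$, let $q>0$ with $q^{2d_i}\neq 1$ for all $i$, and put $q_i=q^{d_i}$. $\mathcal U$ is the unital associative complex algebra $U_q(\mathfrak g)$ generated by $e_i,f_i,k_i,k_i^{-1}$ ($1\le i\le n$) with relations $k_ik_i^{-1}=k_i^{-1}k_i=1$, $k_ik_j=k_jk_i$, $k_ie_j=q_i^{a_{ij}/2}e_jk_i$, $k_if_j=q_i^{-a_{ij}/2}f_jk_i$, $e_if_j-f_je_i=\delta_{ij}\frac{k_i^2-k_i^{-2}}{q_i-q_i^{-1}}$, and for $i\ne j$ the relations $\sum_{\nu=0}^{1-a_{ij}}\binom{1-a_{ij}}{\nu}_{q_i}(-1)^\nu e_i^{1-a_{ij}-\nu}e_je_i^\nu=0$ and the same with $f$ in place of $e$, where $\binom{m}{\nu}_q=\frac{[m]_q!}{[\nu]_q![m-\nu]_q!}$, $[m]_q!=[1]_q\cdots[m]_q$, $[m]_q=\frac{q^m-q^{-m}}{q-q^{-1}}$. It is a bialgebra via $\Delta(e_i)=e_i\otimes k_i^{-1}+k_i\otimes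 e_i$, $\Delta(f_i)=f_i\otimes k_i^{-1}+k_i\otimes f_i$, $\Delta(k_i^{\pm1})=k_i^{\pm1}\otimes k_i^{\pm1}$, $\varepsilon(e_i)=\varepsilon(f_i)=0$, $\varepsilon(k_i^{\pm1})=1$, and a $*$-bialgebra via the antilinear anti-involution $e_i^*=f_i$, $f_i^*=e_i$, $k_i^*=k_i$. For $\mu\in\mathbb Z^n$, $k^\mu=k_1^{\mu_1}\cdots k_n^{\mu_n}$ and $\hat k^\mu=\hat k_1^{\mu_1}\cdots\hat k_n^{\mu_n}$. A unitary representation of $\mathcal U$ on a pre-Hilbert space $D$ is a unital homomorphism $\rho$ to the linear operators on $D$ with $\langle \rho(u)v,w\rangle=\langle v,\rho(u^* )w\rangle$. As in the paper, $D$ is taken to be an orthogonal direct sum of unitary irreducible representations and decomposes into joint eigenspaces of $k_1,\dots,k_n$, with joint eigenvalues of the form $(q^{\lambda_1/2},\dots,q^{\lambda_n/2})$, $\lambda\in\mathbb Z^n$; hence every $\Omega\in D$ has a decomposition as in the claim. Lévy process: a family of $*$-homomorphisms $(j_{st})_{0\le s\le t}$ from a $*$-bialgebra $\mathcal B$ to a $*$-algebra $\mathcal A$ with a fixed state $\Phi$ such that (i) $[j_{st}(\mathcal B),j_{s't'}(\mathcal B)]=\{0\}$ for $0\le s\le t\le s'\le t'$, and $\Phi(j_{s_1t_1}(b_1)\cdots j_{s_mt_m}(b_m))=\prod_l\Phi(j_{s_lt_l}(b_l))$ for $0\le s_1\le t_1\le s_2\le\cdots\le t_m$ and $b_l\in\mathcal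 B$; (ii) $m_{\mathcal A}\circ(j_{st}\otimes j_{tu})\circ\Delta=j_{su}$ for $0\le s\le t\le u$; (iii) $\varphi_{st}=\Phi\circ j_{st}$ depends only on $t-s$; (iv) $j_{ss}(b)=\varepsilon(b)1$ and $j_{st}(b)\to\varepsilon(b)1$ as $t\searrow s$ (in the sense $\Phi(j_{st}(b))\to\varepsilon(b)$). Its generator is the functional $\psi$ with $\Phi\circ j_{st}=\exp_\star((t-s)\psi)=\varepsilon+(t-s)\psi+\frac{(t-s)^2}{2}\psi\star\psi+\cdots$, where $\psi\star\psi=(\psi\otimes\psi)\circ\Delta$ etc. *)

(* Defs.v *)
From HB Require Import structures.
From mathcomp Require Import all_boot all_order all_algebra.
From mathcomp Require Import finmap complex.
From mathcomp Require Import all_classical all_reals all_analysis.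

Set Implicit Arguments.
Unset Strict Implicit.
Unset Printing Implicit Defensive.

Import Order.TTheory GRing.Theory Num.Theory.
Import numFieldNormedType.Exports.

#[global] Open Scope classical_set_scope.
#[global] Open Scope complex_scope.
#[global] Open Scope ring_scope.

Section LieAlgebra.
Context {F : fieldType} {L : vectType F}.
Variable br : L -> L -> L.

Definition lie_bracket : Prop :=
  [/\ forall x, linear (br x),
      forall y, linear (br^~ y),
      forall x, br x x = 0
    & forall x y z, br x (br y z) + br y (br z x) + br z (br x y) = 0].

Definition lie_ideal (I : {vspace L}) : Prop :=
  forall x y, y \in I -> br x y \in I.

Definition simple_lie_algebra : Prop :=
  [/\ lie_bracket,
      exists x y, br x y != 0
    & forall I : {vspace L}, lie_ideal I -> I = 0%VS \/ I = fullv].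

Definition ad_diagonalizable (x : L) : Prop :=
  exists2 X : seq L, basis_of fullv X
    & forall y, y \in X -> exists c : F, br x y = c *: y.

Definition toral (H : {vspace L}) : Prop :=
  (forall x y, x \in H -> y \in H -> br x y \in H) /\
  (forall x, x \in H -> ad_diagonalizable x).

(* For a semisimple Lie algebra over an algebraically closed field of
   characteristic 0 these are the Cartan subalgebras. *)
Definition maximal_toral (H : {vspace L}) : Prop :=
  toral H /\ forall H', toral H' -> (H <= H')%VS -> H' = H.

Section Roots.
Variable H : {vspace L}.
Local Notation dual := 'Hom(subvs_of H, F^o).

Definition root_space (alpha : dual) : set L :=
  [set x | forall h : subvs_of H, br (vsval h) x = (alpha h : F) *: x].

Definition is_root (alpha : dual) : Prop :=
  alpha != 0 /\ exists2 x, x != 0 & root_space alpha x.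

Definition root_base n (alpha : n.-tuple dual) : Prop :=
  [/\ basis_of fullv alpha,
      forall i, is_root (tnth alpha i)
    & forall beta, is_root beta -> exists m : 'I_n -> nat,
        beta = \sum_i tnth alpha i *+ m i \/
        beta = - \sum_i tnth alpha i *+ m i].

Definition is_coroot (alpha : dual) (h : subvs_of H) : Prop :=
  (alpha h = 2%:R :> F) /\
  exists x y, [/\ root_space alpha x, root_space (- alpha) y
                & vsval h = br x y].

End Roots.

(* a_ij = alpha_j(h_i) with h_i the coroot of the simple root alpha_i *)
Definition is_cartan_matrix n (a : 'M[int]_n) : Prop :=
  exists (H : {vspace L}) (alpha : n.-tuple 'Hom(subvs_of H, F^o))
         (h : 'I_n -> subvs_of H),
    [/\ maximal_toral H,
        root_base alpha,
        forall i, is_coroot (tnth alpha i) (h i)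
      & forall i j, tnth alpha j (h i) = (a i j)%:~R :> F].

End LieAlgebra.

Section Tensor.
Context {K : comNzRingType} {A B : lmodType K}.
Local Open Scope quotient_scope.

Definition bilin {W : lmodType K} (f : A -> B -> W) : Prop :=
  (forall x, linear (f x)) /\ (forall y, linear (f^~ y)).

Definition tens_sum {W : zmodType} (f : A -> B -> W) (s : seq (A * B)) : W :=
  \sum_(p <- s) f p.1 p.2.

(* A list of pairs stands for the formal sum of the elementary tensors a (x) b;
   two formal sums agree in the tensor product iff no bilinear map separates
   them. *)
Definition tens_rel (s t : seq (A * B)) : Prop :=
  forall (W : lmodType K) (f : A -> B -> W), bilin f ->
    tens_sum f s = tens_sum f t.

Definition tens_relb : rel (seq (A * B)) := fun s t => `[< tens_rel s t >].

Lemma tens_relb_refl : reflexive tens_relb.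
Proof. by move=> s; apply/asboolP. Qed.

Lemma tens_relb_sym : symmetric tens_relb.
Proof.
by move=> s t; apply/asboolP/asboolP => h W f bf; rewrite (h W f bf).
Qed.

Lemma tens_relb_trans : transitive tens_relb.
Proof.
move=> t s u /asboolP h1 /asboolP h2; apply/asboolP => W f bf.
by rewrite (h1 W f bf) (h2 W f bf).
Qed.

Canonical tens_equiv :=
  EquivRel tens_relb tens_relb_refl tens_relb_sym tens_relb_trans.

Definition tensor := {eq_quot tens_relb}.
HB.instance Definition _ := Choice.on tensor.
HB.instance Definition _ := EqQuotient.on tensor.

(* The linear map on the tensor product induced by a bilinear map f; see
   tens_liftE below. *)
Definition tens_lift {W : zmodType} (f : A -> B -> W) (x : tensor) : W :=
  tens_sum f (repr x).

Lemma tens_lift_pi (W : lmodType K) (f : A -> B -> W) s :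
  bilin f -> tens_lift f (\pi_tensor s) = tens_sum f s.
Proof.
move=> bf; rewrite /tens_lift.
have : tens_relb (repr (\pi_tensor s)) s by apply/eqmodP; rewrite reprK.
by move/asboolP/(_ W f bf).
Qed.

Lemma tensorP (x y : tensor) :
  (forall (W : lmodType K) (f : A -> B -> W), bilin f ->
     tens_lift f x = tens_lift f y) -> x = y.
Proof.
move=> h; rewrite -[x]reprK -[y]reprK; apply/eqmodP/asboolP => W f bf.
exact: h.
Qed.

Definition tens_zero : tensor := \pi_tensor [::].
Definition tens_add (x y : tensor) : tensor := \pi_tensor (repr x ++ repr y).
Definition tens_scale (c : K) (x : tensor) : tensor :=
  \pi_tensor [seq (c *: p.1, p.2) | p <- repr x].
Definition tens_opp : tensor -> tensor := tens_scale (-1).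

Lemma tens_lift0 (W : lmodType K) (f : A -> B -> W) :
  bilin f -> tens_lift f tens_zero = 0.
Proof. by move=> bf; rewrite tens_lift_pi// /tens_sum big_nil. Qed.

Lemma tens_liftD (W : lmodType K) (f : A -> B -> W) x y :
  bilin f -> tens_lift f (tens_add x y) = tens_lift f x + tens_lift f y.
Proof. by move=> bf; rewrite tens_lift_pi// /tens_sum big_cat. Qed.

Lemma tens_liftZ (W : lmodType K) (f : A -> B -> W) c x :
  bilin f -> tens_lift f (tens_scale c x) = c *: tens_lift f x.
Proof.
move=> bf; rewrite tens_lift_pi// /tens_sum big_map scaler_sumr.
apply: eq_bigr => -[a b] _ /=; have l := bf.2 b.
have h0 : f 0 b = 0.
  have := l 1 0 0; rewrite !scale1r addr0 => /eqP.
  by rewrite -subr_eq0 opprD addrA subrr add0r oppr_eq0 => /eqP.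
by have := l c a 0; rewrite h0 !addr0.
Qed.

Lemma tens_addA : associative tens_add.
Proof. by move=> x y z; apply: tensorP => W f bf; rewrite !tens_liftD// addrA. Qed.

Lemma tens_addC : commutative tens_add.
Proof. by move=> x y; apply: tensorP => W f bf; rewrite !tens_liftD// addrC. Qed.

Lemma tens_add0 : left_id tens_zero tens_add.
Proof.
by move=> x; apply: tensorP => W f bf; rewrite tens_liftD// tens_lift0// add0r.
Qed.

Lemma tens_addN : left_inverse tens_zero tens_opp tens_add.
Proof.
move=> x; apply: tensorP => W f bf.
by rewrite tens_liftD// tens_lift0// tens_liftZ// scaleN1r addNr.
Qed.

HB.instance Definition _ :=
  GRing.isZmodule.Build tensor tens_addA tens_addC tens_add0 tens_addN.

Lemma tens_scaleA a b x :
  tens_scale a (tens_scale b x) = tens_scale (a * b) x.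
Proof. by apply: tensorP => W f bf; rewrite !tens_liftZ// scalerA. Qed.

Lemma tens_scale1 : left_id 1 tens_scale.
Proof. by move=> x; apply: tensorP => W f bf; rewrite tens_liftZ// scale1r. Qed.

Lemma tens_scaleDr : right_distributive tens_scale +%R.
Proof.
move=> c x y; apply: tensorP => W f bf.
by rewrite tens_liftZ// !tens_liftD// !tens_liftZ// scalerDr.
Qed.

Lemma tens_scaleDl x : {morph tens_scale^~ x : a b / a + b}.
Proof.
move=> a b; apply: tensorP => W f bf.
by rewrite tens_liftD// !tens_liftZ// scalerDl.
Qed.

HB.instance Definition _ := GRing.Zmodule_isLmodule.Build K tensor
  tens_scaleA tens_scale1 tens_scaleDr tens_scaleDl.

Definition tens (a : A) (b : B) : tensor := \pi_tensor [:: (a, b)].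

Lemma tens_liftE (W : lmodType K) (f : A -> B -> W) a b :
  bilin f -> tens_lift f (tens a b) = f a b.
Proof. by move=> bf; rewrite tens_lift_pi// /tens_sum big_seq1. Qed.

Lemma tens_lift_linear (W : lmodType K) (f : A -> B -> W) :
  bilin f -> linear (tens_lift f).
Proof.
move=> bf c x y; rewrite -(tens_liftZ _ _ bf) -(tens_liftD _ _ bf).
by [].
Qed.

Lemma tens_bilin : bilin tens.
Proof.
split=> [a c b b'|b c a a']; apply: tensorP => W f bf;
  by rewrite tens_lift_linear// !tens_liftE// (bf.1, bf.2).
Qed.

Lemma tens_generate (x : tensor) :
  x = \sum_(p <- repr x) tens p.1 p.2.
Proof.
apply: tensorP => W f bf.
pose g : {linear tensor -> W} := HB.pack (tens_lift f)
  (GRing.isLinear.Build _ _ _ _ _ (tens_lift_linear bf)).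
rewrite -[RHS]/(g _) linear_sum /=; apply: eq_bigr => p _.
by rewrite tens_liftE.
Qed.

End Tensor.

Arguments tensor {K} A B.
Notation "a ⊗ b" := (tens a b) (at level 35, right associativity) : ring_scope.

Section StarBialgebra.
Context {R : realType}.
Local Notation C := R[i].

Definition is_involution (A : algType C) (star : A -> A) : Prop :=
  [/\ forall (c : C) x y, star (c *: x + y) = conjc c *: star x + star y,
      forall x y, star (x * y) = star y * star x
    & involutive star].

Definition tens_mul {A B : algType C} (x y : tensor A B) : tensor A B :=
  tens_lift (fun a b => tens_lift (fun a' b' => (a * a') ⊗ (b * b')) y) x.

Lemma tens_mul_bilin {A B : algType C} (a : A) (b : B) :
  bilin (fun a' b' => (a * a') ⊗ (b * b')).
Proof.
split=> [a' c x y|b' c x y] /=.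
  by rewrite mulrDr -scalerAr (tens_bilin.1 _).
by rewrite mulrDr -scalerAr (tens_bilin.2 _).
Qed.

Lemma tens_mulE {A B : algType C} (a a' : A) (b b' : B) :
  tens_mul (a ⊗ b) (a' ⊗ b') = (a * a') ⊗ (b * b').
Proof.
rewrite /tens_mul tens_liftE ?tens_liftE//; first exact: tens_mul_bilin.
split=> [x c y z|x c y z] /=; rewrite !tens_liftE; do ?exact: tens_mul_bilin.
  by rewrite mulrDl -scalerAl (tens_bilin.1 _).
by rewrite mulrDl -scalerAl (tens_bilin.2 _).
Qed.

Record is_star_bialgebra (B : algType C) (star : B -> B)
    (Delta : B -> tensor B B) (eps : B -> C) : Prop := IsStarBialgebra {
  bialg_star : is_involution star;
  bialg_Delta_linear : linear Delta;
  bialg_Delta1 : Delta 1 = 1 ⊗ 1;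
  bialg_DeltaM : forall x y, Delta (x * y) = tens_mul (Delta x) (Delta y);
  bialg_eps_linear : scalar eps;
  bialg_epsM : monoid_morphism eps;
  (* (Delta (x) id) o Delta = (id (x) Delta) o Delta *)
  bialg_coassoc : forall x,
    tens_lift (fun a b => tens_lift (fun a1 a2 => a1 ⊗ (a2 ⊗ b)) (Delta a))
      (Delta x)
    = tens_lift (fun a b => a ⊗ Delta b) (Delta x) :> tensor B (tensor B B);
  bialg_counitl : forall x, tens_lift (fun a b => eps a *: b) (Delta x) = x;
  bialg_counitr : forall x, tens_lift (fun a b => eps b *: a) (Delta x) = x;
  (* the involution of the tensor square is (a (x) b)^* = a^* (x) b^* *)
  bialg_Delta_star : forall x (s : seq (B * B)),
    Delta x = \sum_(p <- s) p.1 ⊗ p.2 ->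
    Delta (star x) = \sum_(p <- s) star p.1 ⊗ star p.2;
  bialg_eps_star : forall x, eps (star x) = conjc (eps x) }.

Section Convolution.
Context {B : algType C}.
Variables (Delta : B -> tensor B B) (eps : B -> C).

Definition convolution (phi psi : B -> C) (b : B) : C :=
  tens_lift (fun x y => phi x * psi y) (Delta b).

Fixpoint convolution_pow (psi : B -> C) (m : nat) : B -> C :=
  if m is m'.+1 then convolution (convolution_pow psi m') psi else eps.

(* l = exp_*(tau psi)(b), the series being required to converge *)
Definition is_convolution_exp (psi : B -> C) (tau : R) (b : B) (l : C) : Prop :=
  series (fun m => (tau ^+ m / m`!%:R)%:C * convolution_pow psi m b : C^o)
    @ \oo --> (l : C^o).

End Convolution.

Definition is_state (A : algType C) (star : A -> A) (Phi : A -> C) : Prop :=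
  [/\ scalar Phi, Phi 1 = 1 & forall x, 0 <= Phi (star x * x)].

Record is_star_hom (A B : algType C) (starA : A -> A) (starB : B -> B)
    (h : A -> B) : Prop := IsStarHom {
  star_hom_linear : linear h;
  star_homM : monoid_morphism h;
  star_homS : forall x, h (starA x) = starB (h x) }.

Record is_levy_process (B : algType C) (starB : B -> B)
    (Delta : B -> tensor B B) (eps : B -> C)
    (A : algType C) (starA : A -> A) (Phi : A -> C)
    (j : R -> R -> B -> A) : Prop := IsLevyProcess {
  levy_star_hom : forall s t, 0 <= s <= t -> is_star_hom starB starA (j s t);
  levy_commute : forall s t s' t' b b',
    0 <= s <= t -> t <= s' <= t' ->
    j s t b * j s' t' b' = j s' t' b' * j s t b;
  levy_independent : forall m (s t : 'I_m -> R) (b : 'I_m -> B),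
    (forall l, 0 <= s l <= t l) ->
    (forall l l' : 'I_m, (l < l')%N -> t l <= s l') ->
    Phi (\prod_(l < m) j (s l) (t l) (b l))
      = \prod_(l < m) Phi (j (s l) (t l) (b l));
  levy_increment : forall s t u b, 0 <= s <= t -> t <= u ->
    tens_lift (fun x y => j s t x * j t u y) (Delta b) = j s u b;
  levy_stationary : forall s t s' t' b,
    0 <= s <= t -> 0 <= s' <= t' -> t - s = t' - s' ->
    Phi (j s t b) = Phi (j s' t' b);
  levy_start : forall s b, 0 <= s -> j s s b = (eps b)%:A;
  levy_continuous : forall s b, 0 <= s ->
    (Phi (j s t b) : C^o) @[t --> s^'+] --> (eps b : C^o) }.

Definition is_generator (B : algType C) (Delta : B -> tensor B B)
    (eps : B -> C) (A : algType C) (Phi : A -> C) (j : R -> R -> B -> A)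
    (psi : B -> C) : Prop :=
  forall s t b, 0 <= s <= t ->
    is_convolution_exp Delta eps psi (t - s) b (Phi (j s t b)).

End StarBialgebra.

Section QuantumNumbers.
Context {F : fieldType}.
Implicit Types (q : F) (m nu : nat).

Definition qnum q m : F := (q ^+ m - q ^- m) / (q - q^-1).
Definition qfact q m : F := \prod_(1 <= l < m.+1) qnum q l.
Definition qbinom q m nu : F := qfact q m / (qfact q nu * qfact q (m - nu)).

End QuantumNumbers.

Section Uq.
Context {R : realType} {n : nat}.
Local Notation C := R[i].
Variables (a : 'M[int]_n) (d : 'I_n -> int) (q : R).

Definition symmetrizes : Prop :=
  [/\ forall i, d i != 0,
      forall i j, d i * a i j = d j * a j i
    & \big[gcdn/0%N]_(i < n) `|d i|%N = 1%N].

Definition q_ (i : 'I_n) : R := q ^ d i.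

Definition q_half (i j : 'I_n) : R := q_ i `^ ((a i j)%:~R / 2).

Definition serre (U : algType C) (x : 'I_n -> U) (i j : 'I_n) : Prop :=
  let m := `|1 - a i j|%N in (* = 1 - a_ij, since a_ij <= 0 for i <> j *)
  \sum_(nu < m.+1) (qbinom (q_ i) m nu * (-1) ^+ nu)%:C *:
     (x i ^+ (m - nu) * x j * x i ^+ nu) = 0.

(* k' i stands for k_i^(-1) *)
Record Uq_relations (U : algType C) (e f k k' : 'I_n -> U) : Prop :=
    UqRelations {
  Uq_kk' : forall i, k i * k' i = 1;
  Uq_k'k : forall i, k' i * k i = 1;
  Uq_kC : forall i j, k i * k j = k j * k i;
  Uq_ke : forall i j, k i * e j = (q_half i j)%:C *: (e j * k i);
  Uq_kf : forall i j, k i * f j = ((q_half i j)^-1)%:C *: (f j * k i);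
  Uq_ef : forall i j, e i * f j - f j * e i =
    (if i == j then ((q_ i - (q_ i)^-1)^-1)%:C *: (k i ^+ 2 - k' i ^+ 2)
     else 0);
  Uq_serre_e : forall i j : 'I_n, i != j -> serre e i j;
  Uq_serre_f : forall i j : 'I_n, i != j -> serre f i j }.

(* U is the algebra presented by the generators e, f, k, k' and the relations
   above: it is universal among algebras with such elements. *)
Record is_Uq (U : algType C) (e f k k' : 'I_n -> U) : Prop := IsUq {
  Uq_rel : Uq_relations e f k k';
  Uq_lift : forall (V : algType C) (e1 f1 k1 k1' : 'I_n -> V),
    Uq_relations e1 f1 k1 k1' -> exists h : {lrmorphism U -> V}, forall i,
      [/\ h (e i) = e1 i, h (f i) = f1 i, h (k i) = k1 i & h (k' i) = k1' i];
  Uq_lift_uniq : forall (V : algType C) (h1 h2 : {lrmorphism U -> V}),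
    (forall i, [/\ h1 (e i) = h2 (e i), h1 (f i) = h2 (f i),
                   h1 (k i) = h2 (k i) & h1 (k' i) = h2 (k' i)]) ->
    h1 =1 h2 }.

(* the *-bialgebra structure, determined by its values on the generators *)
Record is_Uq_star_bialgebra (U : algType C) (e f k k' : 'I_n -> U)
    (star : U -> U) (Delta : U -> tensor U U) (eps : U -> C) : Prop :=
    IsUqStarBialgebra {
  Uq_star_bialgebra : is_star_bialgebra star Delta eps;
  Uq_Delta_e : forall i, Delta (e i) = e i ⊗ k' i + k i ⊗ e i;
  Uq_Delta_f : forall i, Delta (f i) = f i ⊗ k' i + k i ⊗ f i;
  Uq_Delta_k : forall i, Delta (k i) = k i ⊗ k i;
  Uq_Delta_k' : forall i, Delta (k' i) = k' i ⊗ k' i;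
  Uq_eps_e : forall i, eps (e i) = 0;
  Uq_eps_f : forall i, eps (f i) = 0;
  Uq_eps_k : forall i, eps (k i) = 1;
  Uq_eps_k' : forall i, eps (k' i) = 1;
  Uq_star_e : forall i, star (e i) = f i;
  Uq_star_f : forall i, star (f i) = e i;
  Uq_star_k : forall i, star (k i) = k i }.

Definition zpow (U : algType C) (x x' : U) (m : int) : U :=
  match m with Posz p => x ^+ p | Negz p => x' ^+ p.+1 end.

Definition kmon (U : algType C) (k k' : 'I_n -> U) (mu : 'rV[int]_n) : U :=
  \prod_(i < n) zpow (k i) (k' i) (mu 0 i).

End Uq.

Section UnitaryRep.
Context {R : realType}.
Local Notation C := R[i].
Context {U : algType C} {D : lmodType C}.
Variables (star : U -> U) (ip : {dot D for @conjc R}).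

(* The forms {dot D for conjc} are linear in the first argument; the scalar
   product <v, w> here is linear in the second one. *)
Definition braket (v w : D) : C := ip w v.

Definition sqnorm (v : D) : R := complex.Re (braket v v).

Record is_unitary_rep (rho : U -> D -> D) : Prop := IsUnitaryRep {
  rep_linear_op : forall u, linear (rho u);
  rep_linear : forall (c : C) u u' v,
    rho (c *: u + u') v = c *: rho u v + rho u' v;
  rep1 : forall v, rho 1 v = v;
  repM : forall u u' v, rho (u * u') v = rho u (rho u' v);
  rep_unitary : forall u v w, braket (rho u v) w = braket v (rho (star u) w) }.

Variable rho : U -> D -> D.

Definition invariant_subspace (E : set D) : Prop :=
  [/\ E 0, forall (c : C) x y, E x -> E y -> E (c *: x + y)
    & forall u x, E x -> E (rho u x)].

Definition irreducible_subspace (E : set D) : Prop :=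
  [/\ invariant_subspace E, E != [set 0]
    & forall E' : set D, invariant_subspace E' -> E' `<=` E ->
        E' = [set 0] \/ E' = E].

Definition orthogonal_sum_of_irreducibles : Prop :=
  exists (I : Type) (E : I -> set D),
    [/\ forall i, irreducible_subspace (E i),
        forall i i', i <> i' -> forall x y, E i x -> E i' y -> braket x y = 0
      & forall x : D, exists (r : seq I) (y : I -> D),
          (forall i, E i (y i)) /\ x = \sum_(i <- r) y i].

Context {n : nat}.
Variables (q : R) (k : 'I_n -> U).

Definition weight_vector (lam : 'rV[int]_n) (v : D) : Prop :=
  forall i, rho (k i) v = (q `^ ((lam 0 i)%:~R / 2))%:C *: v.

Definition sum_of_weight_spaces : Prop :=
  forall x : D, exists (Lam : {fset 'rV[int]_n}) (v : 'rV[int]_n -> D),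
    (forall lam, lam \in Lam -> weight_vector lam (v lam)) /\
    x = \sum_(lam <- Lam) v lam.

End UnitaryRep.

Section Poisson.
Context {R : realType} {disp : measure_display} {T : measurableType disp}.
Variable P : probability T R.

Definition independent_classes (I : choiceType) (S : set I)
    (F : I -> set (set T)) : Prop :=
  forall (J : {fset I}) (A : I -> set T),
    [set` J] `<=` S -> (forall i, i \in J -> F i (A i)) ->
    P (\bigcap_(i in [set` J]) A i) = (\prod_(i <- J) P (A i))%E.

Definition sigma_rv (X : T -> nat) : set (set T) :=
  preimage_set_system [set: T] X measurable.

Definition sigma_process (N : R -> T -> nat) : set (set T) :=
  <<s \bigcup_(t in [set t : R | 0 <= t]) sigma_rv (N t) >>.

(* The second argument of poisson_prob is a dummy; poisson_prob 0 is the Dirac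
   mass at 0. The subtraction of naturals is harmless, paths being almost
   surely nondecreasing. *)
Record is_poisson_process (N : R -> T -> nat) : Prop := IsPoissonProcess {
  poisson_measurable : forall t, 0 <= t -> measurable_fun [set: T] (N t);
  poisson_paths : {ae P, forall w,
    [/\ N 0 w = 0%N,
        forall s t, 0 <= s <= t -> (N s w <= N t w)%N
      & forall t, 0 <= t -> \forall u \near t^'+, N u w = N t w]};
  poisson_indep_increments : forall t : nat -> R, 0 <= t 0%N ->
    (forall l, t l <= t l.+1) ->
    independent_classes [set: nat]
      (fun l => sigma_rv (fun w => (N (t l.+1) w - N (t l) w)%N));
  poisson_increments : forall s t, 0 <= s <= t -> forall A : set nat,
    P [set w | A (N t w - N s w)%N] = poisson_prob (t - s) 0%N A }.

Definition independent_processes (I : choiceType) (S : set I)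
    (N : I -> R -> T -> nat) : Prop :=
  independent_classes S (fun i => sigma_process (N i)).

Context {n : nat}.

Definition jump_process (Lam : {fset 'rV[int]_n}) (c : 'rV[int]_n -> R)
    (N : 'rV[int]_n -> R -> T -> nat) (t : R) (w : T) : 'rV[int]_n :=
  \sum_(lam <- Lam) lam *+ N lam (c lam * t) w.

Definition khat (q : R) (N : R -> T -> 'rV[int]_n) (i : 'I_n) (s t : R) (w : T)
    : R :=
  q `^ ((N t w 0 i - N s w 0 i)%:~R / 2).

Definition khat_mon (q : R) (N : R -> T -> 'rV[int]_n) (mu : 'rV[int]_n)
    (s t : R) (w : T) : R :=
  \prod_(i < n) khat q N i s t w ^ (mu 0 i).

End Poisson.

(* Main.v *)
Require Import Defs.
From HB Require Import structures.
From mathcomp Require Import all_boot all_order all_algebra.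
From mathcomp Require Import finmap complex.
From mathcomp Require Import all_classical all_reals all_analysis.
From mathcomp Require Import measurable_realfun.

(** The monomials [k^mu] are group-like, so on them convolution powers become
ordinary powers and [Phi (j s t (k^mu)) = exp ((t - s) * psi (k^mu))].  Weight
vectors of distinct weights are orthogonal, because [k_i] is self-adjoint and
[q <> 1], hence [psi (k^mu) = \sum_lam c_lam (q^(<lam,mu>/2) - 1)], which is the
exponent of the generating function of the increments of
[\sum_lam lam N^lam_(c_lam t)].  Overlapping time intervals are reduced to
disjoint ones: both [j s t (k^mu)] and [khat^mu (s, t)] are multiplicative in
[mu] and under concatenation of intervals, so a product over arbitrary intervals
can be rewritten as a product over the cells of a common refinement, where
independence of increments applies. *)

Set Implicit Arguments.
Unset Strict Implicit.
Unset Printing Implicit Defensive.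

Import Order.TTheory GRing.Theory Num.Theory.
Import numFieldNormedType.Exports.

Section TimeGrid.
Variable R : realDomainType.

Definition time_grid (tau : nat -> R) : Prop :=
  forall p r, (p <= r)%N -> 0 <= tau p <= tau r.

Lemma time_grid_ge0 tau p : time_grid tau -> 0 <= tau p.
Proof. by move=> /(_ p p (leqnn p)) /andP[]. Qed.

Lemma time_grid_le tau p r : time_grid tau -> (p <= r)%N -> tau p <= tau r.
Proof. by move=> tau_grid /tau_grid /andP[]. Qed.

Lemma exists_time_grid (times : seq R) : {in times, forall t, 0 <= t} ->
  exists (tau : nat -> R) (M : nat) (idx : R -> nat),
    time_grid tau /\
    {in times, forall t, tau (idx t) = t /\ (idx t <= M)%N}.
Proof.
move=> times_ge0; pose grid := sort <=%R (0 :: times).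
have size_grid : size grid = (size times).+1 by rewrite size_sort.
have grid_ge0 : {in grid, forall t, 0 <= t}.
  by move=> t; rewrite mem_sort inE => /predU1P[->//|/times_ge0].
have min_lt p : (minn p (size times) < size grid)%N.
  by rewrite size_grid ltnS geq_minr.
exists (fun p => nth 0 grid (minn p (size times))), (size times),
  (index^~ grid).
split=> [p r pr|t times_t].
  have grid_sorted : sorted <=%R grid by rewrite sort_sorted//; exact: le_total.
  rewrite grid_ge0 ?mem_nth//=.
  apply: (sorted_leq_nth le_trans lexx 0 grid_sorted); rewrite ?inE ?min_lt//.
  by rewrite leq_min geq_minr geq_min pr.
have grid_t : t \in grid by rewrite mem_sort inE times_t orbT.
have index_le : (index t grid <= size times)%N.
  by rewrite -ltnS -size_grid index_mem.
by rewrite (minn_idPl index_le) nth_index.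
Qed.

End TimeGrid.

Section MultiplicativeIncrements.
Variables (R : realDomainType) (V : nmodType).

Record multiplicative_increments (A : pzRingType) (h : R -> R -> V -> A) :
    Prop := MultiplicativeIncrements {
  mincr_refl : forall s x, 0 <= s -> h s s x = 1;
  mincr0 : forall s t, 0 <= s <= t -> h s t 0 = 1;
  mincrD : forall s t x y, 0 <= s <= t -> h s t (x + y) = h s t x * h s t y;
  mincr_trans : forall s t u x, 0 <= s <= t -> t <= u ->
    h s u x = h s t x * h t u x;
  mincr_comm : forall s t u v x y, 0 <= s <= t -> t <= u <= v ->
    GRing.comm (h s t x) (h u v y) }.

Section Cells.
Variables (A : pzRingType) (h : R -> R -> V -> A) (tau : nat -> R).
Hypotheses (h_mincr : multiplicative_increments h) (tau_grid : time_grid tau).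
Implicit Types (p a b M : nat) (x y : V).

Lemma mincr_telescope a b x : (a <= b)%N ->
  h (tau a) (tau b) x = \prod_(a <= p < b) h (tau p) (tau p.+1) x.
Proof.
elim: b => [|b IH]; rewrite leq_eqVlt => /predU1P[->|].
- by rewrite big_geq// (mincr_refl h_mincr)// time_grid_ge0.
- by [].
- by rewrite big_geq// (mincr_refl h_mincr)// time_grid_ge0.
rewrite ltnS => ab; rewrite big_nat_recr//= -IH//.
by apply: (mincr_trans h_mincr); [exact: tau_grid|exact: time_grid_le].
Qed.

Lemma mincr_cells a b M x : (a <= b <= M)%N ->
  h (tau a) (tau b) x =
  \prod_(p < M) h (tau p) (tau p.+1) (if (a <= p < b)%N then x else 0).
Proof.
case/andP=> ab bM; rewrite mincr_telescope// (big_nat_widenl _ 0)//.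
rewrite (big_nat_widen _ _ _ _ _ bM) big_mkcond big_mkord.
apply: eq_bigr => p _ /=; case: ifP => // _.
by rewrite (mincr0 h_mincr)// tau_grid.
Qed.

Lemma mincr_cell_comm p r x y :
  GRing.comm (h (tau p) (tau p.+1) x) (h (tau r) (tau r.+1) y).
Proof.
have comm_lt a b x' y' : (a < b)%N ->
    GRing.comm (h (tau a) (tau a.+1) x') (h (tau b) (tau b.+1) y').
  by move=> ab; apply: (mincr_comm h_mincr); rewrite ?tau_grid// !time_grid_le.
have [pr|rp|->] := ltngtP p r; [exact: comm_lt|exact/commr_sym/comm_lt|].
by rewrite /GRing.comm -!(mincrD h_mincr) ?tau_grid// addrC.
Qed.

Lemma mincr_prod_cells (I : Type) (r : seq I) (a b : I -> nat) M (x : I -> V) :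
  (forall l, (a l <= b l <= M)%N) ->
  \prod_(l <- r) h (tau (a l)) (tau (b l)) (x l) =
  \prod_(p < M) h (tau p) (tau p.+1)
    (\sum_(l <- r) if (a l <= p < b l)%N then x l else 0).
Proof.
move=> abM; elim: r => [|l r IH].
  by rewrite big_nil big1// => p _; rewrite big_nil (mincr0 h_mincr)// tau_grid.
rewrite big_cons IH (mincr_cells _ (abM l)) -prodrM_comm => [|p p' _ _].
  by apply: eq_bigr => p _; rewrite big_cons (mincrD h_mincr)// tau_grid.
exact: mincr_cell_comm.
Qed.

End Cells.

Lemma common_refinement (m : nat) (x : 'I_m -> V) (s t : 'I_m -> R) :
  (forall l, 0 <= s l <= t l) ->
  exists (M : nat) (tau : nat -> R) (y : nat -> V), time_grid tau /\
    forall (A : pzRingType) (h : R -> R -> V -> A),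
      multiplicative_increments h ->
      \prod_(l < m) h (s l) (t l) (x l) =
      \prod_(p < M) h (tau p) (tau p.+1) (y p).
Proof.
move=> st.
pose times := [seq s l | l <- enum 'I_m] ++ [seq t l | l <- enum 'I_m].
have times_s l : s l \in times by rewrite mem_cat map_f ?mem_enum.
have times_t l : t l \in times by rewrite mem_cat map_f ?mem_enum ?orbT.
have [u|tau [M [idx [tau_grid tau_idx]]]] := @exists_time_grid R times.
  rewrite mem_cat => /orP[] /mapP[l _ ->]; have /andP[s0 sl_tl] := st l => //.
  exact: le_trans sl_tl.
have idx_le l : (idx (s l) <= idx (t l) <= M)%N.
  have [tau_s _] := tau_idx _ (times_s l).
  have [tau_t ->] := tau_idx _ (times_t l).
  rewrite andbT leqNgt; apply/negP => lt_idx.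
  have /andP[_ sl_tl] := st l.
  have := time_grid_le tau_grid (ltnW lt_idx).
  rewrite tau_s tau_t => tl_sl.
  have /eqP st_eq : s l == t l.
    by rewrite eq_le sl_tl tl_sl.
  by rewrite st_eq ltnn in lt_idx.
exists M, tau, (fun p =>
  \sum_(l < m) if (idx (s l) <= p < idx (t l))%N then x l else 0).
split=> // A h h_mincr; rewrite -(mincr_prod_cells h_mincr tau_grid _ _ idx_le).
apply: eq_bigr => l _.
by rewrite (tau_idx _ (times_s l)).1 (tau_idx _ (times_t l)).1.
Qed.

End MultiplicativeIncrements.

Lemma cvg_real_complex (R : realType) (T : Type) (F : set_system T)
    {FF : Filter F} (u : T -> R) (l : R) :
  u @ F --> l -> ((u x)%:C : R[i]^o) @[x --> F] --> (l%:C : R[i]^o).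
Proof.
move=> /cvgrPdist_lt ul; apply/cvgrPdist_lt => -[x y].
rewrite ltcE /= => /andP[/eqP-> x0]; near=> p.
have -> : l%:C - (u p)%:C = (l - u p)%:C by rewrite rmorphB.
rewrite [X in X < _]normc_def /= expr0n addr0 sqrtr_sqr ltcR.
by near: p; exact: ul.
Unshelve. all: by end_near. Qed.

Section Grouplike.
Context {R : realType} {B : algType R[i]}.
Local Notation C := R[i].
Variables (star : B -> B) (Delta : B -> tensor B B) (eps : B -> C).
Hypothesis hB : is_star_bialgebra star Delta eps.
Implicit Types (phi psi : B -> C) (b : B) (m : nat).

Definition grouplike b : Prop := Delta b = b ⊗ b /\ eps b = 1.

Lemma grouplike1 : grouplike 1.
Proof. by split; [exact: bialg_Delta1 hB|exact: (bialg_epsM hB).1]. Qed.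

Lemma grouplikeM x y : grouplike x -> grouplike y -> grouplike (x * y).
Proof.
move=> [xD x1] [yD y1]; split.
  by rewrite (bialg_DeltaM hB) xD yD tens_mulE.
by rewrite (bialg_epsM hB).2 x1 y1 mulr1.
Qed.

Lemma grouplike_prod (I : Type) (r : seq I) (x : I -> B) :
  (forall i, grouplike (x i)) -> grouplike (\prod_(i <- r) x i).
Proof.
by move=> xG; apply: big_ind => //; [exact: grouplike1|exact: grouplikeM].
Qed.

Lemma grouplikeX x m : grouplike x -> grouplike (x ^+ m).
Proof.
move=> xG; elim: m => [|m IH]; first by rewrite expr0; exact: grouplike1.
by rewrite exprS; exact: grouplikeM.
Qed.

Lemma scalar_mul_bilin phi psi : scalar phi -> scalar psi ->
  bilin (fun x y => phi x * psi y : C^o).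
Proof.
move=> hphi hpsi; split=> [x c y y'|y c x x'].
  by rewrite hpsi mulrDr mulrCA.
by rewrite hphi mulrDl -mulrA.
Qed.

Lemma convolution_scalar phi psi : scalar phi -> scalar psi ->
  scalar (convolution Delta phi psi).
Proof.
move=> hphi hpsi c x y; rewrite /convolution (bialg_Delta_linear hB).
exact: (tens_lift_linear (scalar_mul_bilin hphi hpsi)).
Qed.

Lemma convolution_grouplike phi psi b : scalar phi -> scalar psi ->
  grouplike b -> convolution Delta phi psi b = phi b * psi b.
Proof.
move=> hphi hpsi [bD _]; rewrite /convolution bD.
exact: (tens_liftE _ _ (scalar_mul_bilin hphi hpsi)).
Qed.

Lemma convolution_pow_scalar psi m : scalar psi ->
  scalar (convolution_pow Delta eps psi m).
Proof.
move=> hpsi; elim: m => [|m IH] /=; first exact: (bialg_eps_linear hB).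
exact: convolution_scalar.
Qed.

Lemma convolution_pow_grouplike psi m b : scalar psi -> grouplike b ->
  convolution_pow Delta eps psi m b = psi b ^+ m.
Proof.
move=> hpsi bG; elim: m => [|m IH] /=; first exact: bG.2.
by rewrite convolution_grouplike ?IH ?exprSr//; exact: convolution_pow_scalar.
Qed.

Lemma convolution_exp_grouplike psi (tau x : R) b (l : C) :
  scalar psi -> grouplike b -> psi b = x%:C ->
  is_convolution_exp Delta eps psi tau b l -> l = (expR (tau * x))%:C.
Proof.
move=> hpsi bG psib; rewrite /is_convolution_exp => hl.
have exp_cvg : series (exp_coeff (tau * x)) @ \oo --> expR (tau * x).
  exact: is_cvg_series_exp_coeff.
apply: (cvg_unique (@norm_hausdorff _ C^o) hl).
apply: cvg_trans (cvg_real_complex exp_cvg); apply: near_eq_cvg; near=> m.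
rewrite /series /= rmorph_sum; apply: eq_bigr => p _.
rewrite convolution_pow_grouplike// psib -rmorphXn -rmorphM.
by congr (_%:C); rewrite /exp_coeff /= exprMn mulrAC.
Unshelve. all: by end_near. Qed.

End Grouplike.

Section LevyGrouplike.
Context {R : realType} {B A : algType R[i]}.
Variables (starB : B -> B) (Delta : B -> tensor B B) (eps : B -> R[i]).
Variables (starA : A -> A) (Phi : A -> R[i]) (j : R -> R -> B -> A).
Hypothesis hj : is_levy_process starB Delta eps starA Phi j.

Lemma levy_increment_grouplike s t u b : 0 <= s <= t -> t <= u ->
  grouplike Delta eps b -> j s u b = j s t b * j t u b.
Proof.
move=> st tu [bD _]; have /andP[s0 s_le_t] := st.
have tu' : 0 <= t <= u by rewrite tu (le_trans s0).
rewrite -(levy_increment hj _ st tu) bD tens_liftE//.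
have lin_st := star_hom_linear (levy_star_hom hj st).
have lin_tu := star_hom_linear (levy_star_hom hj tu').
split=> [x c y y'|y c x x'].
  by rewrite lin_tu mulrDr scalerAr.
by rewrite lin_st mulrDl scalerAl.
Qed.

Lemma levy_grouplike_mincr (V : nmodType) (g : V -> B) :
  g 0 = 1 -> {morph g : x y / x + y >-> x * y} ->
  (forall x, grouplike Delta eps (g x)) ->
  multiplicative_increments (fun s t x => j s t (g x)).
Proof.
move=> g0 gD gG; split=> [s x s0|s t st|s t x y st|s t u x st tu|s t u v x y].
- by rewrite (levy_start hj)// (gG x).2 scale1r.
- by rewrite g0 (star_homM (levy_star_hom hj st)).1.
- by rewrite gD (star_homM (levy_star_hom hj st)).2.
- exact: levy_increment_grouplike.
- exact: (levy_commute hj).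
Qed.

Lemma levy_grouplike_moment (psi : B -> R[i]) (M : nat) (tau x : nat -> R)
    (b : nat -> B) :
  is_star_bialgebra starB Delta eps -> is_generator Delta eps Phi j psi ->
  scalar psi -> time_grid tau -> (forall p, grouplike Delta eps (b p)) ->
  (forall p, psi (b p) = (x p)%:C) ->
  Phi (\prod_(p < M) j (tau p) (tau p.+1) (b p)) =
  (\prod_(p < M) expR ((tau p.+1 - tau p) * x p))%:C.
Proof.
move=> hB hpsi psi_scalar tau_grid bG psi_b.
rewrite (levy_independent hj) => [|p|p r pr]; last exact: time_grid_le.
  rewrite rmorph_prod; apply: eq_bigr => p _.
  apply: (convolution_exp_grouplike hB psi_scalar (bG p) (psi_b p)).
  by apply: hpsi; exact: tau_grid.
exact: tau_grid.
Qed.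

End LevyGrouplike.

Lemma comm_inverse (A : pzRingType) (x y y' : A) :
  y * y' = 1 -> y' * y = 1 -> GRing.comm x y -> GRing.comm x y'.
Proof.
move=> yy' y'y xy; rewrite /GRing.comm.
by rewrite -[LHS]mul1r -y'y -mulrA [y * _]mulrA -xy -!mulrA yy' mulr1.
Qed.

Section IntegerPowers.
Context {R : realType} {U : algType R[i]}.
Implicit Types (x y : U) (m p : int).

Lemma comm_zpow x y y' m : y * y' = 1 -> y' * y = 1 ->
  GRing.comm x y -> GRing.comm x (zpow y y' m).
Proof.
move=> yy' y'y xy; case: m => m /=; apply: commrX => //.
exact: comm_inverse yy' y'y xy.
Qed.

Section ZpowAdditivity.
Variables (x x' : U).
Hypotheses (xx' : x * x' = 1) (x'x : x' * x = 1).

Lemma zpow_succ m : zpow x x' (m + 1) = zpow x x' m * x.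
Proof.
case: m => [m|[|m]].
- by rewrite -PoszD addn1 /= exprSr.
- by rewrite /= x'x.
- by rewrite NegzE addrC subzSS sub0r -NegzE /= [in RHS]exprSr -mulrA x'x mulr1.
Qed.

Lemma zpow_pred m : zpow x x' (m - 1) = zpow x x' m * x'.
Proof. by rewrite -[in RHS](subrK 1 m) zpow_succ -mulrA xx' mulr1. Qed.

Lemma zpowD m p : zpow x x' (m + p) = zpow x x' m * zpow x x' p.
Proof.
elim: p => [|p IH|p IH]; first by rewrite addr0 mulr1.
  by rewrite -addn1 PoszD addrA !zpow_succ IH mulrA.
by rewrite -addn1 PoszD opprD addrA !zpow_pred IH mulrA.
Qed.

End ZpowAdditivity.

Section Monomials.
Variables (n : nat) (k k' : 'I_n -> U).
Implicit Types mu nu : 'rV[int]_n.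

Lemma kmon0 : kmon k k' 0 = 1.
Proof. by rewrite /kmon big1// => i _; rewrite mxE. Qed.

Lemma kmonD mu nu :
  (forall i, k i * k' i = 1) -> (forall i, k' i * k i = 1) ->
  (forall i j, GRing.comm (k i) (k j)) ->
  kmon k k' (mu + nu) = kmon k k' mu * kmon k k' nu.
Proof.
move=> kk' k'k kC; rewrite /kmon -prodrM_comm => [|i j _ _].
  by apply: eq_bigr => i _; rewrite mxE zpowD.
by apply: comm_zpow => //; apply/commr_sym/comm_zpow.
Qed.

Lemma kmon_grouplike star (Delta : U -> tensor U U) (eps : U -> R[i]) mu :
  is_star_bialgebra star Delta eps ->
  (forall i, grouplike Delta eps (k i)) ->
  (forall i, grouplike Delta eps (k' i)) ->
  grouplike Delta eps (kmon k k' mu).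
Proof.
move=> hB kG k'G; apply: (grouplike_prod hB) => i.
by case: (mu 0 i) => m /=; apply: (grouplikeX hB).
Qed.

End Monomials.

End IntegerPowers.

Lemma Uq_kmon_grouplike (R : realType) (n : nat) (U : algType R[i])
    (e f k k' : 'I_n -> U) (star : U -> U) (Delta : U -> tensor U U)
    (eps : U -> R[i]) (mu : 'rV[int]_n) :
  is_Uq_star_bialgebra e f k k' star Delta eps ->
  grouplike Delta eps (kmon k k' mu).
Proof.
move=> hU; apply: (kmon_grouplike _ (Uq_star_bialgebra hU)) => i; split.
- exact: Uq_Delta_k hU i.
- exact: Uq_eps_k hU i.
- exact: Uq_Delta_k' hU i.
- exact: Uq_eps_k' hU i.
Qed.

Section WeightCharacters.
Context {R : realType} {n : nat}.
Variable q : R.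
Hypothesis q_gt0 : 0 < q.
Implicit Types lam mu nu : 'rV[int]_n.

(* [q^(<lam,mu>/2)], the eigenvalue of [k^mu] on the weight space of [lam] *)
Definition weight_char lam mu : R :=
  \prod_(i < n) (q `^ ((lam 0 i)%:~R / 2)) ^ mu 0 i.

Lemma weight_char_gt0 lam mu : 0 < weight_char lam mu.
Proof. by apply: prodr_gt0 => i _; rewrite exprz_gt0// powR_gt0. Qed.

Lemma weight_char0l mu : weight_char 0 mu = 1.
Proof. by apply: big1 => i _; rewrite mxE mul0r powRr0 exp1rz. Qed.

Lemma weight_char0r lam : weight_char lam 0 = 1.
Proof. by apply: big1 => i _; rewrite mxE expr0z. Qed.

Lemma weight_charDl lam lam' mu :
  weight_char (lam + lam') mu = weight_char lam mu * weight_char lam' mu.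
Proof.
rewrite /weight_char -big_split; apply: eq_bigr => i _ /=.
by rewrite mxE intrD mulrDl powRD ?expfzMl// (gt_eqF q_gt0) implybT.
Qed.

Lemma weight_charDr lam mu nu :
  weight_char lam (mu + nu) = weight_char lam mu * weight_char lam nu.
Proof.
rewrite /weight_char -big_split; apply: eq_bigr => i _.
by rewrite mxE expfzDr// gt_eqF// powR_gt0.
Qed.

Lemma weight_charBl lam lam' mu :
  weight_char (lam - lam') mu = weight_char lam mu / weight_char lam' mu.
Proof.
apply: (mulIf (lt0r_neq0 (weight_char_gt0 lam' mu))).
by rewrite -weight_charDl subrK divfK// gt_eqF// weight_char_gt0.
Qed.

Lemma weight_char_sum (I : Type) (r : seq I) (lam : I -> 'rV[int]_n)
    (m : I -> nat) mu :
  weight_char (\sum_(i <- r) lam i *+ m i) mu =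
  \prod_(i <- r) weight_char (lam i) mu ^+ m i.
Proof.
have charD x y := weight_charDl x y mu.
rewrite (big_morph (weight_char^~ mu) charD (weight_char0l mu)).
apply: eq_bigr => i _; elim: (m i) => [|p IH].
  by rewrite mulr0n weight_char0l.
by rewrite mulrS charD IH exprS.
Qed.

Lemma khat_monE (disp : measure_display) (T : measurableType disp)
    (N : R -> T -> 'rV[int]_n) mu s t w :
  khat_mon q N mu s t w = weight_char (N t w - N s w) mu.
Proof. by apply: eq_bigr => i _; rewrite /khat !mxE. Qed.

Lemma khat_mon_gt0 (disp : measure_display) (T : measurableType disp)
    (N : R -> T -> 'rV[int]_n) mu s t w :
  0 < khat_mon q N mu s t w.
Proof. by rewrite khat_monE weight_char_gt0. Qed.

Lemma khat_mon_mincr (disp : measure_display) (T : measurableType disp)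
    (N : R -> T -> 'rV[int]_n) (w : T) :
  multiplicative_increments (fun s t mu => khat_mon q N mu s t w).
Proof.
split=> [s mu _|s t _|s t mu nu _|s t u mu _ _|s t u v mu nu _ _];
  rewrite ?khat_monE.
- by rewrite subrr weight_char0l.
- exact: weight_char0r.
- exact: weight_charDr.
- by rewrite -weight_charDl (addrC (N t w - _)) subrKA.
- exact: mulrC.
Qed.

Definition jump_exponent (Lam : {fset 'rV[int]_n}) (c : 'rV[int]_n -> R) mu
    : R :=
  \sum_(lam <- Lam) c lam * (weight_char lam mu - 1).

End WeightCharacters.

Section UnitaryRepresentation.
Context {R : realType} {U : algType R[i]} {D : lmodType R[i]}.
Local Notation C := R[i].
Variables (star : U -> U) (ip : {dot D for @conjc R}) (rho : U -> D -> D).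
Hypothesis hrho : is_unitary_rep star ip rho.

Lemma dot_sqnorm (v : D) : ip v v = (sqnorm ip v)%:C.
Proof. by rewrite /sqnorm RRe_real// ger0_real// dnorm_ge0. Qed.

Lemma sqnorm_ge0 (v : D) : 0 <= sqnorm ip v.
Proof. by rewrite -lecR -dot_sqnorm; exact: dnorm_ge0. Qed.

Lemma repZ u (c : C) v : rho u (c *: v) = c *: rho u v.
Proof. exact: (GRing.scalable_linear (rep_linear_op hrho u)). Qed.

Lemma rep_sum (I : Type) (r : seq I) u (v : I -> D) :
  rho u (\sum_(i <- r) v i) = \sum_(i <- r) rho u (v i).
Proof.
pose rho_u : {linear D -> D} := HB.pack (rho u)
  (GRing.isLinear.Build _ _ _ _ _ (rep_linear_op hrho u)).
exact: (linear_sum rho_u).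
Qed.

Lemma repX_eigen u m v (c : C) :
  rho u v = c *: v -> rho (u ^+ m) v = c ^+ m *: v.
Proof.
move=> uv; elim: m => [|m IH]; first by rewrite !expr0 (rep1 hrho) scale1r.
by rewrite exprSr (repM hrho) uv repZ IH scalerA exprS.
Qed.

Definition rep_generator (eps : U -> C) (Omega : D) (u : U) : C :=
  braket ip Omega (rho u Omega - eps u *: Omega).

Lemma rep_generator_scalar (eps : U -> C) (Omega : D) :
  scalar eps -> scalar (rep_generator eps Omega).
Proof.
move=> eps_scalar c u u'.
rewrite /rep_generator (rep_linear hrho) eps_scalar.
rewrite scalerDl opprD addrACA -scalerA -scalerBr /braket linearDl.
by rewrite linearZl_LR.
Qed.

Section Weights.
Context {n : nat}.
Variables (q : R) (k k' : 'I_n -> U).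
Hypotheses (q_gt0 : 0 < q) (k'k : forall i, k' i * k i = 1).
Implicit Types (lam mu : 'rV[int]_n) (v : D).

Lemma rep_kmon lam mu v : weight_vector rho q k lam v ->
  rho (kmon k k' mu) v = (weight_char q lam mu)%:C *: v.
Proof.
move=> kv; rewrite /kmon /weight_char.
apply: (big_rec2 (fun (u : U) (z : R) => rho u v = z%:C *: v)).
  by rewrite (rep1 hrho) scale1r.
move=> i z u _ uv; rewrite (repM hrho) uv repZ.
rewrite rmorphM mulrC -scalerA; congr (_ *: _); set c := q `^ _.
have c0 : c != 0 by rewrite gt_eqF// powR_gt0.
have k'v : rho (k' i) v = (c^-1)%:C *: v.
  rewrite -[in RHS](rep1 hrho v) -(k'k i) (repM hrho) kv.
  by rewrite repZ scalerA -rmorphM mulVf// scale1r.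
case: (mu 0 i) => m /=.
  by rewrite (repX_eigen _ (kv i)) -rmorphXn.
by rewrite (repX_eigen _ k'v) -rmorphXn exprVn.
Qed.

(* For [n = 0] the only weight is [0], and [q = 1] is allowed. *)
Hypothesis q_neq1 : 'I_n -> q != 1.
Hypothesis star_k : forall i, star (k i) = k i.

Lemma weight_vector_orthogonal lam lam' v v' : lam != lam' ->
  weight_vector rho q k lam v -> weight_vector rho q k lam' v' ->
  ip v v' = 0.
Proof.
move=> neq_lam kv kv'.
have [i neq_i] : exists i, lam 0 i != lam' 0 i.
  apply/existsP; apply: contraR neq_lam => /existsPn eq_lam.
  by apply/eqP/rowP => i; apply/eqP; have := eq_lam i; rewrite negbK.
have ipZr c : ip v (c%:C *: v') = c%:C * ip v v' by rewrite linearZr /= oppr0.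
have := rep_unitary hrho (k i) v' v; rewrite star_k kv kv' /braket.
rewrite linearZl_LR ipZr => /eqP.
rewrite -subr_eq0 -mulrBl -rmorphB mulf_eq0 => /orP[|/eqP//].
rewrite fmorph_eq0 subr_eq0 /powR (gt_eqF q_gt0) => /eqP/expR_inj/eqP.
rewrite (inj_eq (mulIf _)) ?ln_eq0 ?q_neq1// (inj_eq (mulIf _)) ?invr_eq0//.
by rewrite eqr_int eq_sym (negPf neq_i).
Qed.

Lemma rep_generator_kmon (eps : U -> C) (Omega : D) (Lam : {fset 'rV[int]_n})
    (v : 'rV[int]_n -> D) mu :
  eps (kmon k k' mu) = 1 -> Omega = \sum_(lam <- Lam) v lam ->
  (forall lam, lam \in Lam -> weight_vector rho q k lam (v lam)) ->
  rep_generator eps Omega (kmon k k' mu) =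
  (jump_exponent q Lam (fun lam => sqnorm ip (v lam)) mu)%:C.
Proof.
move=> eps1 OmegaE v_weight; rewrite /rep_generator eps1 scale1r.
have -> : rho (kmon k k' mu) Omega - Omega =
    \sum_(lam <- Lam) (weight_char q lam mu - 1)%:C *: v lam.
  rewrite OmegaE rep_sum -sumrB big_seq [RHS]big_seq.
  apply: eq_bigr => lam /v_weight v_lam.
  by rewrite /= (rep_kmon _ v_lam) rmorphB scalerBl scale1r.
rewrite /braket linear_sumlz rmorph_sum /= big_seq [RHS]big_seq.
apply: eq_bigr => lam lamL; rewrite linearZl_LR /= mulrC rmorphM; congr (_ * _).
rewrite OmegaE linear_sumr (bigD1_seq lam) ?fset_uniq//= dot_sqnorm big1_seq.
  by rewrite addr0.
move=> lam' /andP[neq_lam /v_weight v_lam']; rewrite eq_sym in neq_lam.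
exact: weight_vector_orthogonal neq_lam (v_weight _ lamL) v_lam'.
Qed.

End Weights.

End UnitaryRepresentation.

Section NatFibers.
Context {R : realType} {disp : measure_display} {T : measurableType disp}.
Local Open Scope ereal_scope.
Implicit Types (D : set T) (Y : T -> nat).

Lemma measurable_nat_comp D Y (f : nat -> R) :
  measurable_fun setT Y -> measurable_fun D (fun w => f (Y w)).
Proof.
by move=> mY; apply: measurable_funTS; apply: (@measurableT_comp _ _ _ _ _ _ f).
Qed.

Lemma measurable_nat_preimage Y (A : set nat) :
  measurable_fun setT Y -> measurable (Y @^-1` A).
Proof. by move=> mY; rewrite -[X in measurable X]setTI; exact: mY. Qed.

Variable mu : {measure set T -> \bar R}.

Lemma ge0_integral_nat_fibers D Y (g : T -> \bar R) :
  measurable D -> measurable_fun setT Y -> measurable_fun D g ->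
  (forall w, D w -> 0 <= g w) ->
  \int[mu]_(w in D) g w =
  \sum_(x <oo) \int[mu]_(w in D `&` Y @^-1` [set x]) g w.
Proof.
move=> mD mY mg g0.
have DE : D = (\bigcup_x (D `&` Y @^-1` [set x]))%classic.
  by apply/seteqP; split=> [w Dw|w [x _ []//]]; exists (Y w).
rewrite {1}DE ge0_integral_bigcup -?DE//.
  by move=> x; apply: measurableI => //; exact: measurable_nat_preimage.
by apply: trivIset_setIl; exact: trivIset_preimage1.
Qed.

Lemma ge0_integral_nat_comp D Y (f : nat -> R) :
  measurable D -> measurable_fun setT Y -> (forall x, (0 <= f x)%R) ->
  \int[mu]_(w in D) (f (Y w))%:E =
  \sum_(x <oo) (f x)%:E * mu (D `&` Y @^-1` [set x]).
Proof.
move=> mD mY f0; rewrite (ge0_integral_nat_fibers mD mY)//.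
- apply: eq_eseriesr => x _; rewrite -integral_cst; last first.
    by apply: measurableI => //; exact: measurable_nat_preimage.
  by apply: eq_integral => w; rewrite inE => -[_ /= ->].
- exact/measurable_EFinP/measurable_nat_comp.
- by move=> w _; rewrite lee_fin.
Qed.

Lemma ge0_integral_nat_compM D Y (f : nat -> R) (g : T -> R) (c : \bar R) :
  measurable D -> measurable_fun setT Y -> measurable_fun setT g ->
  (forall x, (0 <= f x)%R) -> (forall w, (0 <= g w)%R) -> 0 <= c ->
  (forall x, \int[mu]_(w in D `&` Y @^-1` [set x]) (g w)%:E =
     c * mu (Y @^-1` [set x])) ->
  \int[mu]_(w in D) (f (Y w) * g w)%:E = c * \int[mu]_w (f (Y w))%:E.
Proof.
move=> mD mY mg f0 g0 c0 g_fiber.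
have mfY E : measurable_fun E (fun w => f (Y w)) by exact: measurable_nat_comp.
have mgE E : measurable_fun E g by exact: measurable_funTS.
rewrite (ge0_integral_nat_fibers mD mY); first last.
- by move=> w _; rewrite lee_fin mulr_ge0.
- exact/measurable_EFinP/measurable_funM.
rewrite -ge0_integralZl//; first last.
- by move=> w _; rewrite lee_fin.
- exact/measurable_EFinP.
rewrite [RHS](ge0_integral_nat_fibers _ mY)//; first last.
- by move=> w _; rewrite mule_ge0// lee_fin.
- by apply: measurable_funeM; exact/measurable_EFinP.
apply: eq_eseriesr => x _; rewrite setTI.
have mDx : measurable (D `&` Y @^-1` [set x]).
  by apply: measurableI => //; exact: measurable_nat_preimage.
transitivity (\int[mu]_(w in D `&` Y @^-1` [set x]) ((f x)%:E * (g w)%:E)).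
  by apply: eq_integral => w; rewrite inE => -[_ /= ->]; rewrite EFinM.
rewrite ge0_integralZl_EFin//; first last.
- exact/measurable_EFinP.
- by move=> w _; rewrite lee_fin.
rewrite g_fiber muleA [_ * c]muleC -integral_cst; last first.
  exact: measurable_nat_preimage.
by apply: eq_integral => w; rewrite inE => /= ->.
Qed.

End NatFibers.

Section IndependentProducts.
Context {R : realType} {disp : measure_display} {T : measurableType disp}.
Variables (P : probability T R) (I : choiceType) (Y : I -> T -> nat).
Local Open Scope ereal_scope.
Implicit Types (D : set T) (r : seq I) (J : {fset I}).

Definition independent_with D r : Prop := forall A : I -> set nat,
  P (D `&` \bigcap_(i in [set` r]) Y i @^-1` A i) =
  P D * \prod_(i <- r) P (Y i @^-1` A i).

Lemma independent_with_fiber D i r x :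
  i \notin r -> independent_with D (i :: r) ->
  P (D `&` Y i @^-1` [set x]) = P D * P (Y i @^-1` [set x]) /\
  independent_with (D `&` Y i @^-1` [set x]) r.
Proof.
move=> ir indDir; set Dx := D `&` Y i @^-1` [set x].
have P_Dx A : P (Dx `&` \bigcap_(k in [set` r]) Y k @^-1` A k) =
    P D * P (Y i @^-1` [set x]) * \prod_(k <- r) P (Y k @^-1` A k).
  have neq_i k : k \in r -> (k == i) = false.
    by move=> kr; apply: contraNF ir => /eqP<-.
  have := indDir (fun k => if k == i then [set x]%classic else A k).
  rewrite !bigcap_seq !big_cons eqxx setIA -!bigcap_seq -muleA.
  rewrite (@eq_bigcapr _ _ _ _ (fun k => Y k @^-1` A k)); last first.
    by move=> k /= kr; rewrite neq_i.
  move=> ->; congr (_ * (_ * _)); rewrite big_seq [RHS]big_seq.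
  by apply: eq_bigr => k kr; rewrite neq_i.
have P_DxE : P Dx = P D * P (Y i @^-1` [set x]).
  have := P_Dx (fun=> setT).
  rewrite (_ : (\bigcap_(k in _) _)%classic = setT); last exact/seteqP.
  rewrite setIT => ->.
  by rewrite big1 ?mule1// => k _; rewrite preimage_setT probability_setT.
by split=> // A; rewrite P_Dx P_DxE.
Qed.

(* The event [D] makes the induction go through: fixing the value of one
   variable shrinks [D] and leaves the others independent. *)
Lemma integral_prod_independent_with D r (f : I -> nat -> R) :
  uniq r -> measurable D -> {in r, forall i, measurable_fun setT (Y i)} ->
  (forall i x, (0 <= f i x)%R) -> independent_with D r ->
  \int[P]_(w in D) (\prod_(i <- r) f i (Y i w))%:E =
  P D * \prod_(i <- r) \int[P]_w (f i (Y i w))%:E.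
Proof.
move=> + + + f0; elim: r D => [|i r IH] D /= => [_ mD _ _|].
  under eq_integral do rewrite big_nil.
  by rewrite integral_cst// big_nil muleC.
case/andP=> ir ur mD mY indD.
have mYi : measurable_fun setT (Y i) by apply: mY; rewrite mem_head.
have mYr : {in r, forall k, measurable_fun setT (Y k)}.
  by move=> k kr; apply: mY; rewrite in_cons kr orbT.
have int_ge0 k : 0 <= \int[P]_w (f k (Y k w))%:E.
  by apply: integral_ge0 => w _; rewrite lee_fin.
under eq_integral do rewrite big_cons.
rewrite (@ge0_integral_nat_compM _ _ _ _ _ _ _ _
  (P D * \prod_(k <- r) \int[P]_w (f k (Y k w))%:E))//.
- by rewrite big_cons -muleA [in LHS](muleC (\prod_(k <- r) _)).
- by apply: measurable_prod => k /mYr; exact: measurable_nat_comp.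
- by move=> w; rewrite prodr_ge0.
- by rewrite mule_ge0// prode_ge0.
move=> x; have [P_Dx indDx] := independent_with_fiber x ir indD.
rewrite IH// ?P_Dx 1?muleAC//.
by apply: measurableI => //; exact: measurable_nat_preimage.
Qed.

Lemma integral_prod_independent J (f : I -> nat -> R) :
  {in J, forall i, measurable_fun setT (Y i)} -> (forall i x, (0 <= f i x)%R) ->
  independent_classes P [set` J] (fun i => sigma_rv (Y i)) ->
  \int[P]_w (\prod_(i <- J) f i (Y i w))%:E =
  \prod_(i <- J) \int[P]_w (f i (Y i w))%:E.
Proof.
move=> mY f0 indY.
rewrite integral_prod_independent_with ?fset_uniq//.
  by rewrite probability_setT mul1e.
move=> A; rewrite setTI probability_setT mul1e indY// => i _.
by exists (A i); rewrite ?setTI.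
Qed.

End IndependentProducts.

Lemma big_fset_fst (I K : choiceType) (Z : Type) (idx : Z)
    (op : Monoid.com_law idx) (J : {fset I * K}) (F : I * K -> Z) :
  \big[op/idx]_(x <- J) F x =
  \big[op/idx]_(i <- [fset x.1 | x in J]%fset)
    \big[op/idx]_(k <- [fset x.2 | x in J & x.1 == i]%fset) F (i, k).
Proof.
rewrite (partition_big_imfset _ fst); apply: eq_bigr => i _.
rewrite big_imfset => [|[i1 k1] [i2 k2]] /=; last first.
  by case/andP=> _ /eqP + /andP[_ /eqP] => /= -> -> ->.
by rewrite big_filter; apply: eq_bigr => -[i' k] /= /eqP->.
Qed.

Section IndependentPairs.
Context {R : realType} {disp : measure_display} {T : measurableType disp}.
Variables (P : probability T R) (I K : choiceType).

Lemma independent_classes_pair (S : set I) (F : I -> K -> set (set T))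
    (G : I -> set (set T)) :
  independent_classes P S G ->
  (forall i, S i -> independent_classes P setT (F i)) ->
  (forall i (J : {fset K}) (A : K -> set T), S i ->
     (forall k, k \in J -> F i k (A k)) ->
     G i (\bigcap_(k in [set` J]) A k)%classic) ->
  independent_classes P (S `*` setT)%classic (fun x => F x.1 x.2).
Proof.
move=> indG indF capG J A JS FA.
have memS i : i \in [fset x.1 | x in J]%fset -> S i.
  by case/imfsetP => x /= xJ ->; case: (JS x xJ).
have FAi i k : k \in [fset x.2 | x in J & x.1 == i]%fset -> F i k (A (i, k)).
  by case/imfsetP=> -[i' k'] /=; rewrite !inE /= => /andP[/FA + /eqP<-] ->.
have -> : (\bigcap_(x in [set` J]) A x =
    \bigcap_(i in [set` [fset x.1 | x in J]%fset])
      \bigcap_(k in [set` [fset x.2 | x in J & x.1 == i]%fset])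
        A (i, k))%classic.
  rewrite !bigcap_fset big_fset_fst; apply: eq_bigr => i _.
  by rewrite bigcap_fset.
rewrite indG// => [|i /memS Si]; last exact: capG (FAi i).
rewrite big_fset_fst big_seq [RHS]big_seq; apply: eq_bigr => i /memS Si.
by rewrite (indF i Si)//; exact: FAi.
Qed.

End IndependentPairs.

Section PoissonDistribution.
Context {R : realType}.
Local Open Scope ereal_scope.

Lemma poisson_prob_set1 (rate : R) (x : nat) : (0 <= rate)%R ->
  poisson_prob rate 0 [set x] = (rate ^+ x / x`!%:R * expR (- rate))%:E.
Proof.
rewrite le_eqVlt => /predU1P[<-|rate0]; rewrite /poisson_prob.
  rewrite ltxx diracE expr0n oppr0 expR0 mulr1.
  case: x => [|x]; first by rewrite mem_set// divr1.
  by rewrite memNset// mul0r.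
by rewrite rate0 esum_set1 ?lee_fin ?poisson_pmf_ge0// /poisson_pmf rate0.
Qed.

Lemma poisson_generating_function (rate z : R) : (0 <= rate)%R -> (0 <= z)%R ->
  \sum_(x <oo) (z ^+ x)%:E * poisson_prob rate 0 [set x] =
  (expR (rate * (z - 1)))%:E.
Proof.
move=> rate0 z0.
transitivity (\sum_(x <oo) (expR (- rate))%:E * (exp_coeff (rate * z) x)%:E).
  apply: eq_eseriesr => x _; rewrite poisson_prob_set1// -!EFinM; congr (_%:E).
  rewrite /exp_coeff /= exprMn mulrA mulrC; congr (_ * _)%R.
  by rewrite mulrA (mulrC (z ^+ x)%R).
rewrite nneseriesZl => [|x _]; last by rewrite lee_fin exp_coeff_ge0// mulr_ge0.
rewrite mulrBr mulr1 addrC expRD EFinM; congr (_ * _).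
rewrite [in RHS]/expR -EFin_lim; last exact: is_cvg_series_exp_coeff.
by apply/congr_lim/funext => m /=; rewrite /series /= -sumEFin.
Qed.

End PoissonDistribution.

Section CountingIncrements.
Context {R : realType} {disp : measure_display} {T : measurableType disp}.
Implicit Types (N : R -> T -> nat) (tau : nat -> R).

Definition increment N (s t : R) (w : T) : nat := (N t w - N s w)%N.

Lemma sigma_process_increments N tau (J : {fset nat}) (A : nat -> set T) :
  (forall p, 0 <= tau p) ->
  (forall p, p \in J -> sigma_rv (increment N (tau p) (tau p.+1)) (A p)) ->
  sigma_process N (\bigcap_(p in [set` J]) A p)%classic.
Proof.
move=> tau0 JA; rewrite /sigma_process; set G := (\bigcup_(t in _) _)%classic.
have mN t : 0 <= t ->
    measurable_fun [set: g_sigma_algebraType G] (N t).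
  by move=> t0 _ B _; apply: sub_sigma_algebra; exists t => //; exists B.
change (measurable
  ((\bigcap_(p in [set` J]) A p)%classic : set (g_sigma_algebraType G))).
apply: fin_bigcap_measurable => // p /JA[B _ <-]; rewrite setTI.
apply: (@measurable_nat_preimage _ (g_sigma_algebraType G)).
by apply: measurable_fun_subn; exact: mN.
Qed.

Variable P : probability T R.

Lemma measurable_increment N s t : is_poisson_process P N -> 0 <= s <= t ->
  measurable_fun setT (increment N s t).
Proof.
move=> hN /andP[s0 st]; apply: measurable_fun_subn.
  exact: (poisson_measurable hN (le_trans s0 st)).
exact: (poisson_measurable hN s0).
Qed.

Lemma integral_increment N s t z : is_poisson_process P N -> 0 <= s <= t ->
  0 <= z ->
  (\int[P]_w (z ^+ increment N s t w)%:E)%E = (expR ((t - s) * (z - 1)))%:E.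
Proof.
move=> hN st z0.
rewrite (ge0_integral_nat_comp P measurableT (measurable_increment hN st)).
  have /andP[_ s_le_t] := st.
  rewrite -poisson_generating_function ?subr_ge0//; apply: eq_eseriesr => x _.
  by rewrite setTI -(poisson_increments hN st).
by move=> x; exact: exprn_ge0.
Qed.

Section Family.
Variables (I : choiceType) (Lam : {fset I}) (N : I -> R -> T -> nat).
Variable tau : I -> nat -> R.
Hypothesis hN : forall i, i \in Lam -> is_poisson_process P (N i).
Hypothesis indN : independent_processes P [set` Lam] N.
Hypothesis tau_grid : forall i, time_grid (tau i).

Lemma independent_increments :
  independent_classes P ([set` Lam] `*` setT)%classic
    (fun x => sigma_rv (increment (N x.1) (tau x.1 x.2) (tau x.1 x.2.+1))).
Proof.
apply: (independent_classes_pair (F := fun i p =>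
  sigma_rv (increment (N i) (tau i p) (tau i p.+1))) indN).
  move=> i /hN hNi; apply: (poisson_indep_increments hNi) => [|p].
    exact: time_grid_ge0.
  exact: time_grid_le.
move=> i J A _; apply: sigma_process_increments => p; exact: time_grid_ge0.
Qed.

Lemma integral_prod_increments (M : nat) (z : I -> nat -> R) :
  (forall i p, 0 <= z i p) ->
  (\int[P]_w (\prod_(i <- Lam) \prod_(p < M)
     z i p ^+ increment (N i) (tau i p) (tau i p.+1) w)%:E)%E =
  (\prod_(i <- Lam) \prod_(p < M)
     expR ((tau i p.+1 - tau i p) * (z i p - 1)))%:E.
Proof.
move=> z0; pose cells := (Lam `*` [fset p in iota 0 M])%fset.
have cellsE (F : I -> nat -> R) :
    \prod_(i <- Lam) \prod_(p < M) F i p = \prod_(x <- cells) F x.1 x.2.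
  rewrite (big_imfset2 _ _ (fun x => F x.1 x.2)) /=; last first.
    by move=> [i p] [i' p'] _ _ /= [-> ->].
  apply: eq_bigr => i _; rewrite big_imfset//= undup_id ?iota_uniq//.
  by rewrite -(big_mkord xpredT (F i)) /index_iota subn0.
have cells_Lam x : x \in cells -> x.1 \in Lam by rewrite in_fsetM => /andP[].
pose incr x := increment (N x.1) (tau x.1 x.2) (tau x.1 x.2.+1).
have int_incr x : x \in cells -> (\int[P]_w (z x.1 x.2 ^+ incr x w)%:E =
    (expR ((tau x.1 x.2.+1 - tau x.1 x.2) * (z x.1 x.2 - 1)))%:E)%E.
  by move=> /cells_Lam/hN hNi; apply: integral_increment => //; exact: tau_grid.
rewrite (cellsE (fun i p => expR ((tau i p.+1 - tau i p) * (z i p - 1)))).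
under eq_integral => w _ do
  rewrite (cellsE (fun i p => z i p ^+ incr (i, p) w)).
rewrite (integral_prod_independent (Y := incr)
  (f := fun x m => z x.1 x.2 ^+ m)).
- by rewrite -prodEFin big_seq [RHS]big_seq; exact: eq_bigr.
- move=> x /cells_Lam/hN hNi; apply: measurable_increment hNi _.
  exact: tau_grid.
- by move=> x m; exact: exprn_ge0.
by move=> J A Jcells; apply: independent_increments => x /Jcells /cells_Lam.
Qed.

End Family.

End CountingIncrements.

Lemma ge0_integrable (R : realType) (disp : measure_display)
    (T : measurableType disp) (mu : {measure set T -> \bar R}) (f : T -> R)
    (r : R) :
  measurable_fun setT f -> (forall w, 0 <= f w) ->
  (\int[mu]_w (f w)%:E = r%:E)%E -> mu.-integrable setT (EFin \o f).
Proof.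
move=> mf f0 intf; apply/integrableP; split; first exact/measurable_EFinP.
under eq_integral do rewrite /= ger0_norm//.
by rewrite intf ltry.
Qed.

Section JumpProcess.
Context {R : realType} {n : nat} {disp : measure_display}.
Context {T : measurableType disp}.
Variables (P : probability T R) (q : R).
Variables (Lam : {fset 'rV[int]_n}) (c : 'rV[int]_n -> R).
Variable Np : 'rV[int]_n -> R -> T -> nat.
Hypotheses (q_gt0 : 0 < q) (c_ge0 : forall lam, 0 <= c lam).
Hypothesis hNp : forall lam, lam \in Lam -> is_poisson_process P (Np lam).
Hypothesis indNp : independent_processes P [set` Lam] Np.
Local Notation N := (jump_process Lam c Np).
Implicit Types (mu : 'rV[int]_n) (s t : R) (w : T).

Lemma jump_process_increment_ae : {ae P, forall w, forall s t, 0 <= s <= t ->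
  N t w - N s w =
  \sum_(lam <- Lam) lam *+ increment (Np lam) (c lam * s) (c lam * t) w}.
Proof.
have : {ae P, forall w, (\bigcap_(lam in [set` Lam]) [set w | forall u u',
    0 <= u <= u' -> (Np lam u w <= Np lam u' w)%N])%classic w}.
  apply: filter_bigI => lam lamL; have := poisson_paths (hNp lamL).
  by apply: filterS => w [].
apply: filterS => w Np_nd s t /andP[s0 st].
rewrite /jump_process -sumrB big_seq [RHS]big_seq; apply: eq_bigr => lam lamL.
rewrite mulrnBr//; apply: (Np_nd lam lamL).
by rewrite mulr_ge0//= ler_wpM2l.
Qed.

Lemma khat_mon_ae : {ae P, forall w, forall mu s t, 0 <= s <= t ->
  khat_mon q N mu s t w = \prod_(lam <- Lam)
    weight_char q lam mu ^+ increment (Np lam) (c lam * s) (c lam * t) w}.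
Proof.
apply: filterS jump_process_increment_ae => w N_incr mu s t st.
by rewrite khat_monE N_incr// weight_char_sum.
Qed.

Lemma measurable_khat_mon mu s t : 0 <= s <= t ->
  measurable_fun setT (khat_mon q N mu s t).
Proof.
case/andP=> s0 st; have t0 := le_trans s0 st.
have mNp lam u : lam \in Lam -> 0 <= u ->
    measurable_fun setT (Np lam (c lam * u)).
  by move=> lamL u0; apply: (poisson_measurable (hNp lamL)); rewrite mulr_ge0.
rewrite (_ : khat_mon q N mu s t = fun w => \prod_(lam <- Lam)
    (weight_char q lam mu ^+ Np lam (c lam * t) w *
     weight_char q lam mu ^- Np lam (c lam * s) w)); last first.
  apply/funext => w; rewrite khat_monE weight_charBl// !weight_char_sum//.
  by rewrite prodf_div.
apply: measurable_prod => lam lamL; apply: measurable_funM.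
  exact: (measurable_nat_comp (fun i => weight_char q lam mu ^+ i))
    (mNp _ _ lamL t0).
exact: (measurable_nat_comp (fun i => weight_char q lam mu ^- i))
  (mNp _ _ lamL s0).
Qed.

Lemma integral_prod_khat_mon (M : nat) (tau : nat -> R)
    (nu : nat -> 'rV[int]_n) :
  time_grid tau ->
  (\int[P]_w (\prod_(p < M) khat_mon q N (nu p) (tau p) (tau p.+1) w)%:E)%E =
  (\prod_(p < M) expR ((tau p.+1 - tau p) * jump_exponent q Lam c (nu p)))%:E.
Proof.
move=> tau_grid; pose ctau lam p := c lam * tau p.
have ctau_grid lam : time_grid (ctau lam).
  move=> p r pr; rewrite mulr_ge0 ?ler_wpM2l//.
    exact: time_grid_le tau_grid pr.
  exact: time_grid_ge0 tau_grid.
have cell p : 0 <= tau p <= tau p.+1 by exact: tau_grid.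
have char_ge0 lam p : 0 <= weight_char q lam (nu p).
  exact/ltW/weight_char_gt0.
transitivity (\int[P]_w (\prod_(lam <- Lam) \prod_(p < M)
    weight_char q lam (nu p) ^+
      increment (Np lam) (ctau lam p) (ctau lam p.+1) w)%:E)%E.
  apply: ge0_ae_eq_integral => //.
  - apply/measurable_EFinP/measurable_prod => p _.
    exact: measurable_khat_mon (cell p).
  - apply/measurable_EFinP/measurable_prod => lam lamL.
    apply: measurable_prod => p _.
    apply: (measurable_nat_comp (fun i => weight_char q lam (nu p) ^+ i)).
    by apply: measurable_increment (hNp lamL) _; exact: ctau_grid.
  - by move=> w _; rewrite lee_fin prodr_ge0// => p _; exact/ltW/khat_mon_gt0.
  - move=> w _; rewrite lee_fin prodr_ge0// => lam _.
    by rewrite prodr_ge0// => p _; exact: exprn_ge0.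
  apply: filterS khat_mon_ae => w khatE _; congr (_%:E).
  by rewrite [RHS]exchange_big; apply: eq_bigr => p _; rewrite khatE.
rewrite (integral_prod_increments hNp indNp ctau_grid M char_ge0) exchange_big.
congr (_%:E); apply: eq_bigr => p _; rewrite -expR_sum mulr_sumr.
by congr expR; apply: eq_bigr => lam _; rewrite /ctau -mulrBr mulrCA mulrA.
Qed.

Lemma integrable_prod_khat_mon (m : nat) (mu : 'I_m -> 'rV[int]_n)
    (s t : 'I_m -> R) :
  (forall l, 0 <= s l <= t l) ->
  P.-integrable setT
    (EFin \o (fun w => \prod_(l < m) khat_mon q N (mu l) (s l) (t l) w)).
Proof.
move=> st; have [M [tau [nu [tau_grid refine]]]] := common_refinement mu st.
apply: (@ge0_integrable _ _ _ P) => [|w|].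
- by apply: measurable_prod => l _; exact: measurable_khat_mon (st l).
- by rewrite prodr_ge0// => l _; exact/ltW/khat_mon_gt0.
under eq_integral do rewrite (refine _ _ (khat_mon_mincr q_gt0 N _)).
exact: integral_prod_khat_mon.
Qed.

End JumpProcess.

Theorem theorem5p1 (R : realType) (n : nat)
  (* a complex simple Lie algebra with Cartan matrix a *)
  (L : vectType R[i]) (br : L -> L -> L) (hL : simple_lie_algebra br)
  (a : 'M[int]_n) (ha : is_cartan_matrix br a)
  (d : 'I_n -> int) (hd : symmetrizes a d)
  (q : R) (hq : 0 < q) (hqd : forall i, q ^ (2 * d i) != 1)
  (* the *-bialgebra U_q(g_c) *)
  (U : algType R[i]) (e f k k' : 'I_n -> U) (hU : is_Uq a d q e f k k')
  (starU : U -> U) (Delta : U -> tensor U U) (eps : U -> R[i])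
  (hbi : is_Uq_star_bialgebra e f k k' starU Delta eps)
  (* a unitary representation on a pre-Hilbert space *)
  (D : lmodType R[i]) (ip : {dot D for @conjc R}) (rho : U -> D -> D)
  (hrho : is_unitary_rep starU ip rho)
  (hirr : orthogonal_sum_of_irreducibles ip rho)
  (hwt : sum_of_weight_spaces rho q k)
  (Omega : D)
  (* a Levy process with the given generator *)
  (A : algType R[i]) (starA : A -> A) (hA : is_involution starA)
  (Phi : A -> R[i]) (hPhi : is_state starA Phi)
  (j : R -> R -> U -> A)
  (hj : is_levy_process starU Delta eps starA Phi j)
  (hpsi : is_generator Delta eps Phi j
     (fun u => braket ip Omega (rho u Omega - eps u *: Omega)))
  (* the weight decomposition of Omega *)
  (Lam : {fset 'rV[int]_n}) (v : 'rV[int]_n -> D)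
  (hOmega : Omega = \sum_(lam <- Lam) v lam)
  (hv : forall lam, lam \in Lam -> weight_vector rho q k lam (v lam))
  (* independent Poisson processes *)
  (disp : measure_display) (T : measurableType disp) (P : probability T R)
  (Np : 'rV[int]_n -> R -> T -> nat)
  (hNp : forall lam, lam \in Lam -> is_poisson_process P (Np lam))
  (hind : independent_processes P [set` Lam] Np) :
  let N := jump_process Lam (fun lam => sqnorm ip (v lam)) Np in
  forall (m : nat) (mu : 'I_m -> 'rV[int]_n) (s t : 'I_m -> R),
    (forall l, 0 <= s l <= t l) ->
    let X := fun w : T => \prod_(l < m) khat_mon q N (mu l) (s l) (t l) w in
    P.-integrable [set: T] (EFin \o X) /\
    Phi (\prod_(l < m) j (s l) (t l) (kmon k k' (mu l))) = (fine 'E_P[X])%:C.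
Proof.
move=> N m mu s t st X.
have [hB [kk' k'k kC _ _ _ _ _]] := (Uq_star_bialgebra hbi, Uq_rel hU).
have kmonG nu := Uq_kmon_grouplike nu hbi.
have q_neq1 (i : 'I_n) : q != 1.
  by apply: contraNneq (hqd i) => ->; rewrite exp1rz.
have c_ge0 lam : 0 <= sqnorm ip (v lam) by exact: sqnorm_ge0.
split; first exact: integrable_prod_khat_mon.
have [M [tau [nu [tau_grid refine]]]] := common_refinement mu st.
have psi_kmon p := rep_generator_kmon hrho hq k'k q_neq1 (Uq_star_k hbi)
  (kmonG (nu p)).2 hOmega hv.
rewrite (refine _ _ (levy_grouplike_mincr hj (kmon0 k k') _ kmonG)); last first.
  by move=> x y; exact: kmonD.
have psi_scalar := rep_generator_scalar hrho Omega (bialg_eps_linear hB).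
rewrite (levy_grouplike_moment hj M hB hpsi psi_scalar tau_grid _ psi_kmon)//.
have -> : ('E_P[X] = \int[P]_w (X w)%:E)%E by rewrite unlock.
under eq_integral do rewrite /X (refine _ _ (khat_mon_mincr hq N _)).
by rewrite (integral_prod_khat_mon hq c_ge0 hNp hind).
Qed.
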